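(* Let $\mathbf{x}\in\mathbb{R}^N$ be an unknown vector with known sparsity $m=\|\mathbf{x}\|_0$ and support $\Omega$, and let $\mathbf{s}=\boldsymbol{\Phi}\mathbf{x}+\sigma\boldsymbol{\xi}$, where $\boldsymbol{\Phi}\in\mathbb{R}^{p\times N}$ is a dictionary with normalized (unit-norm) columns and coherence $\mu$, $\sigma>0$, and $\boldsymbol{\xi}\sim N(\mathbf{0},\mathbf{I}_p)$. Suppose that $\mu<\frac{1}{2m-1}$, that $m\le N^{\beta}$ for some $0<\beta<1$, and that for some $\alpha\ge 0$ $$x_{\min}\ \ge\ \frac{\sigma}{1-(2m-1)\mu}\left(1+\sqrt{\beta}\right)\sqrt{2(1+\alpha)\log N},$$ where $x_{\min}=\min_{i\in\Omega}|\mathbf{x}_i|$. Then OMP with $m$ iterations (run on input $\boldsymbol{\Phi},\mathbf{s},m$) successfully recovers the support of $\mathbf{x}$ with probability at least $$1-\frac{1}{\sqrt{\pi(1+\alpha)\log N}}\left(\frac{1}{N^{\alpha}}+\frac{1}{N^{\alpha\beta}\sqrt{\beta}}\right).$$ Moreover, under the same conditions, OMP* with threshold $\tau=\sigma\sqrt{2(1+\alpha)\log N}$ successfully recovers the support of $\mathbf{x}$ with probability at least this same quantity.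
   Context: Notation: $[N]=\{1,\dots,N\}$; $\boldsymbol{\varphi}_1,\dots,\boldsymbol{\varphi}_N\in\mathbb{R}^p$ are the columns (atoms) of the dictionary $\boldsymbol{\Phi}$; $\|\mathbf{x}\|_0=|\operatorname{supp}(\mathbf{x})|$ is the number of non-zero entries; $\Omega=\operatorname{supp}(\mathbf{x})$. The coherence is $\mu=\mu(\boldsymbol{\Phi})=\max_{i\ne j}|\langle\boldsymbol{\varphi}_i,\boldsymbol{\varphi}_j\rangle|$ (so $N\ge 2$). The vector $\mathbf{x}$ and dictionary $\boldsymbol{\Phi}$ are fixed; probability is over $\boldsymbol{\xi}$. OMP (Orthogonal Matching Pursuit) with input $\boldsymbol{\Phi}$, $\mathbf{s}$, $m$: set $\mathbf{r}_0=\mathbf{s}$ and $\hat\Omega_0=\emptyset$. For $t=1,\dots,m$: choose $j\in\arg\max\{|\langle\boldsymbol{\varphi}_i,\mathbf{r}_{t-1}\rangle|: i\in[N]\}$; set $\hat\Omega_t=\hat\Omega_{t-1}\cup\{j\}$; let $\hat{\mathbf{x}}_t$ minimize $\|\mathbf{s}-\boldsymbol{\Phi}\mathbf{z}\|_2$ over $\mathbf{z}\in\mathbb{R}^N$ supported on $\hat\Omega_t$; set $\mathbf{r}_t=\mathbf{s}-\boldsymbol{\Phi}\hat{\mathbf{x}}_t$. The output is $\hat{\mathbf{x}}_m$ with estimated support $\hat\Omega_m$. OMP* with threshold $\tau$ is the variant in which, instead of performing $m$ iterations, the algorithm stops when the maximal correlation of the residual with any atom is at most the threshold, i.e. at the first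 $t$ with $\|\boldsymbol{\Phi}^T\mathbf{r}_t\|_\infty\le\tau$, and its estimated support is then $\hat\Omega_t$. ''Successfully recovers the support of $\mathbf{x}$'' means that the final estimated support equals $\Omega$. *)

(* Defs.v *)
From HB Require Import structures.
From mathcomp Require Import all_boot all_order all_algebra.
From mathcomp Require Import all_classical all_reals all_analysis.

Set Implicit Arguments.
Unset Strict Implicit.
Unset Printing Implicit Defensive.
Import Order.TTheory GRing.Theory Num.Theory.
Import numFieldNormedType.Exports.

Local Open Scope classical_set_scope.
Local Open Scope ring_scope.

Section Vectors.
Context {R : realType}.

Definition dotv p (u v : 'cV[R]_p) : R := \sum_i u i 0 * v i 0.

Definition l2norm p (u : 'cV[R]_p) : R := Num.sqrt (dotv u u).

Definition supp N (x : 'cV[R]_N) : {set 'I_N} := [set i | x i 0 != 0]%SET.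

Definition l0norm N (x : 'cV[R]_N) : nat := #|supp x|.

(* The initial value `|x| is the sup norm of x, hence neutral for this minimum
   as soon as supp x is nonempty. *)
Definition xmin N (x : 'cV[R]_N) : R :=
  \big[Num.min/`|x|]_(i in supp x) `|x i 0|.

End Vectors.

Section Dictionary.
Context {R : realType} {p N : nat}.
Implicit Types (Phi : 'M[R]_(p, N)) (s : 'cV[R]_p).

Definition atom Phi (i : 'I_N) : 'cV[R]_p := col i Phi.

Definition normalized Phi : Prop := forall i, l2norm (atom Phi i) = 1.

(* All terms are nonnegative, so 0 is neutral for this maximum when N >= 2. *)
Definition coherence Phi : R :=
  \big[Num.max/0]_(ij : 'I_N * 'I_N | ij.1 != ij.2)
     `|dotv (atom Phi ij.1) (atom Phi ij.2)|.

Definition is_argmax_corr Phi (r : 'cV[R]_p) (j : 'I_N) : Prop :=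
  forall i, `|dotv (atom Phi i) r| <= `|dotv (atom Phi j) r|.

Definition is_least_squares Phi s (S : {set 'I_N}) (z : 'cV[R]_N) : Prop :=
  supp z \subset S /\
  forall z', supp z' \subset S ->
    l2norm (s - Phi *m z) <= l2norm (s - Phi *m z').

(* One possible execution of the iteration, continued for ever; OMP and OMP*
   differ only in the time at which they read it off.  Ties in the arg max (and
   between least-squares minimizers) may be broken arbitrarily.  The iteration
   never blocks, so the first n steps of these sequences are exactly the
   possible executions of n steps.  The value xh 0 is not used. *)
Record omp_run Phi s (S : nat -> {set 'I_N}) (xh : nat -> 'cV[R]_N)
    (r : nat -> 'cV[R]_p) : Prop := OmpRun {
  omp_run_r0 : r 0%N = s;
  omp_run_S0 : S 0%N = finset.set0;
  omp_run_select : forall t, exists j,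
    is_argmax_corr Phi (r t) j /\ S t.+1 = (j |: S t)%SET;
  omp_run_estimate : forall t, is_least_squares Phi s (S t.+1) (xh t.+1);
  omp_run_residual : forall t, r t.+1 = s - Phi *m xh t.+1
}.

(* Recovery is required however the ties are broken; the first conjunct rules
   out vacuous success. *)
Definition omp_recovers Phi s (m : nat) (Omega : {set 'I_N}) : Prop :=
  (exists S xh r, omp_run Phi s S xh r) /\
  (forall S xh r, omp_run Phi s S xh r -> S m = Omega).

(* `|_| on matrices is the sup norm. *)
Definition omp_star_stops_at Phi (tau : R) (r : nat -> 'cV[R]_p) (t : nat)
    : Prop :=
  `|Phi^T *m r t| <= tau /\
  forall t', (t' < t)%N -> tau < `|Phi^T *m r t'|.

Definition omp_star_recovers Phi s (tau : R) (Omega : {set 'I_N}) : Prop :=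
  (exists S xh r, omp_run Phi s S xh r) /\
  (forall S xh r, omp_run Phi s S xh r ->
     exists t, omp_star_stops_at Phi tau r t /\ S t = Omega).

End Dictionary.

Section Noise.
Context d (T : measurableType d) (R : realType) (P : probability T R).
Context (p : nat).

(* Taking some of the B i equal to setT gives the product rule for
   subfamilies. *)
Definition mutually_independent (xi : 'I_p -> {RV P >-> R}) : Prop :=
  forall B : 'I_p -> set R, (forall i, measurable (B i)) ->
    P [set w | forall i, B i (xi i w)] = (\prod_(i < p) P (xi i @^-1` B i))%E.

(* xi ~ N(0, I_p): independent coordinates with the standard normal law. *)
Definition standard_gaussian_vector (xi : 'I_p -> {RV P >-> R}) : Prop :=
  mutually_independent xi /\
  forall i (B : set R), measurable B ->
    distribution P (xi i) B = normal_prob 0 1 B.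

Definition noisy_signal N (Phi : 'M[R]_(p, N)) (x : 'cV[R]_N) (sigma : R)
    (xi : 'I_p -> {RV P >-> R}) (w : T) : 'cV[R]_p :=
  Phi *m x + sigma *: \col_i xi i w.

End Noise.

Definition recovery_bound {R : realType} (N : nat) (alpha beta : R) : R :=
  1 - (Num.sqrt (pi * (1 + alpha) * ln N%:R))^-1 *
      ((N%:R `^ alpha)^-1 + (N%:R `^ (alpha * beta) * Num.sqrt beta)^-1).

(* Main.v *)
Require Import Defs.
From HB Require Import structures.
From mathcomp Require Import all_boot all_order all_algebra.
From mathcomp Require Import all_classical all_reals all_analysis.
From mathcomp Require Import measurable_realfun.
From mathcomp Require Import ring lra.
Import Order.TTheory GRing.Theory Num.Theory.
Import numFieldNormedType.Exports.
Local Open Scope classical_set_scope.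
Local Open Scope ring_scope.

(* Let Q be the orthogonal projection off the span of the atoms of the support
   Omega, xi the noise and u = sqrt (2 (1 + alpha) log N).  Recovery holds on the
   event where |<phi_i, xi>| < sqrt beta u for i in Omega and |<Q phi_i, xi>| < u
   for i not in Omega.

   Deterministic part: let xt be the least-squares solution on Omega.  As long as
   the selected set S is inside Omega, the residual is Phi y + Q (sigma xi) with
   y := xt - (least-squares solution on S), and its second term is orthogonal to
   the atoms of Omega.  If M is the largest entry of |y|, some atom of Omega has
   correlation at least (1 - (m - 1) mu) M, while those outside Omega stay below
   m mu M + sigma u.  Since y = xt on Omega minus S and xt is within
   sigma sqrt beta u / (1 - (2 m - 1) mu) of x, we get
   (1 - (2 m - 1) mu) M > sigma u, so the selected atom is a new one of Omega and
   OMP* does not stop.  Once S = Omega the residual is Q (sigma xi), so OMP*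
   stops.  Projecting the noise is what makes the same event serve OMP and OMP*.

   Probabilistic part: the vectors phi_i and Q phi_i have norm at most 1, so the
   tests are centered Gaussians of variance at most 1, and a union bound over the
   tail estimate P (|Z| >= t) <= 2 phi(t) / t concludes. *)

(** * Least squares *)

Section DotProduct.
Context {R : realType} {p : nat}.
Implicit Types u v w : 'cV[R]_p.

Lemma dotvE u v : dotv u v = (u^T *m v) 0 0.
Proof. by rewrite mxE; apply: eq_bigr => i _; rewrite mxE. Qed.

Lemma dotvC u v : dotv u v = dotv v u.
Proof. by apply: eq_bigr => i _; rewrite mulrC. Qed.

Lemma dotvDr u v w : dotv u (v + w) = dotv u v + dotv u w.
Proof. by rewrite !dotvE mulmxDr mxE. Qed.

Lemma dotvBr u v w : dotv u (v - w) = dotv u v - dotv u w.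
Proof. by rewrite !dotvE mulmxBr !mxE. Qed.

Lemma dotvZr a u v : dotv u (a *: v) = a * dotv u v.
Proof. by rewrite !dotvE -scalemxAr mxE. Qed.

Lemma dotvDl u v w : dotv (v + w) u = dotv v u + dotv w u.
Proof. by rewrite ![dotv _ u]dotvC dotvDr. Qed.

Lemma dotvv_ge0 u : 0 <= dotv u u.
Proof. by apply: sumr_ge0 => i _; rewrite -expr2 sqr_ge0. Qed.

Lemma dotvv_eq0 u : dotv u u = 0 -> u = 0.
Proof.
move=> /eqP; rewrite psumr_eq0; last by move=> i _; rewrite -expr2 sqr_ge0.
move=> /allP u0; apply/colP => i; rewrite mxE.
by have := u0 i (mem_index_enum i); rewrite /= -expr2 sqrf_eq0 => /eqP.
Qed.

Lemma pythagoras u v : dotv u v = 0 ->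
  dotv (u + v) (u + v) = dotv u u + dotv v v.
Proof. by move=> uv; rewrite dotvDl !dotvDr (dotvC v u) uv addr0 add0r. Qed.

End DotProduct.

Lemma dotv_mulmx {R : realType} {p q} (A : 'M[R]_(p, q)) u (z : 'cV[R]_q) :
  dotv u (A *m z) = dotv (A^T *m u) z.
Proof. by rewrite !dotvE trmx_mul trmxK mulmxA. Qed.

(** * Least-squares residuals as orthogonal projections *)

Section LeastSquares.
Context {R : realType} {p N : nat} (Phi : 'M[R]_(p, N)).
Implicit Types (s : 'cV[R]_p) (z : 'cV[R]_N) (S : {set 'I_N}).

Lemma supp_subP z S : reflect (forall i, i \notin S -> z i 0 = 0)
  (supp z \subset S).
Proof.
apply: (iffP idP) => [/fintype.subsetP zS i iS|zS].
  by apply: contraNeq iS => zi; apply: zS; rewrite inE.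
by apply/fintype.subsetP => i; rewrite inE; apply: contraNT => /zS/eqP.
Qed.

Lemma supp_subB S z z' : supp z \subset S -> supp z' \subset S ->
  supp (z - z') \subset S.
Proof.
move=> /supp_subP zS /supp_subP z'S; apply/supp_subP => i iS.
by rewrite !mxE zS// z'S// subr0.
Qed.

Lemma dotv_dict u z :
  dotv u (Phi *m z) = \sum_j z j 0 * dotv (atom Phi j) u.
Proof.
rewrite dotv_mulmx; apply: eq_bigr => j _; rewrite mulrC; congr (_ * _).
by rewrite mxE; apply: eq_bigr => i _; rewrite !mxE.
Qed.

Lemma dotv_supp0 S u z : supp z \subset S ->
  (forall i, i \in S -> dotv (atom Phi i) u = 0) -> dotv u (Phi *m z) = 0.
Proof.
move=> /supp_subP zS u0; rewrite dotv_dict big1// => j _.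
by have [/u0->|/zS->] := boolP (j \in S); rewrite ?mulr0 ?mul0r.
Qed.

(** A row vector [v = u A^T] with [v A = 0] has [v v^T = 0], so the row space of [A^T] meets the
    kernel of [A] trivially. Hence [A^T A] has the rank of [A], and its row space, contained in that
    of [A], is all of it. *)
Lemma sub_gram {q} (A : 'M[R]_(p, q)) : (A <= A^T *m A)%MS.
Proof.
have cap0 : (A^T :&: kermx A)%MS = 0.
  apply/eqP; rewrite -submx0; apply/row_subP => i; set v := row i _.
  have /submxP[u vE] : (v <= A^T)%MS by rewrite (submx_trans (row_sub _ _))// capmxSl.
  have /sub_kermxP vA : (v <= kermx A)%MS by rewrite (submx_trans (row_sub _ _))// capmxSr.
  suff -> : v = 0 by exact: sub0mx.
  apply: trmx_inj; rewrite trmx0; apply: dotvv_eq0.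
  by rewrite dotvE trmxK [in X in X 0 0]vE trmx_mul trmxK mulmxA -vE vA mul0mx mxE.
have := mxrank_mul_ker A^T A; rewrite cap0 mxrank0 addn0 mxrank_tr => rk.
by rewrite -(geq_leqif (mxrank_leqif_sup (submxMl A^T A))) rk.
Qed.

(** By [sub_gram], [A P (A^T A) = A] for [P] the chosen inverse of [A^T A]; transposing gives
    [A^T A X = A^T] with [X = P^T A^T]. *)
Lemma normal_equations {q} (A : 'M[R]_(p, q)) :
  A^T *m (A *m ((pinvmx (A^T *m A))^T *m A^T)) = A^T.
Proof.
have := mulmxKpV (sub_gram A); move: (pinvmx _) => P AP.
by rewrite -[in RHS]AP !trmx_mul trmxK !mulmxA.
Qed.

(** Zeroes what lies outside [S] instead of deleting it, so that matrix sizes do not depend on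
    [S]. *)
Let mask S : 'M[R]_N := diag_mx (\row_i (i \in S)%:R).
Let sub_dict S := Phi *m mask S.

(* [pinvmx] is not the Moore-Penrose inverse; it only solves the normal
   equations, which are consistent by [sub_gram]. *)
Definition lsq S : 'M[R]_(N, p) :=
  let A := sub_dict S in
  mask S *m ((pinvmx (A^T *m A))^T *m A^T).

(** The orthogonal projection off the span of the atoms of [S]. *)
Definition resid S : 'M[R]_p := 1%:M - Phi *m lsq S.

Let mask_supp S q (z : 'M[R]_(N, q)) i j : i \notin S -> (mask S *m z) i j = 0.
Proof. by move=> iS; rewrite mul_diag_mx !mxE (negbTE iS) mul0r. Qed.

Lemma supp_lsq S s : supp (lsq S *m s) \subset S.
Proof. by apply/supp_subP => i iS; rewrite -mulmxA mask_supp. Qed.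

Lemma residE S s : resid S *m s = s - Phi *m (lsq S *m s).
Proof. by rewrite mulmxBl mul1mx mulmxA. Qed.

Lemma resid_orth S s i : i \in S -> dotv (atom Phi i) (resid S *m s) = 0.
Proof.
move=> iS; pose A := sub_dict S.
have AQ : A^T *m resid S = 0.
  by rewrite /resid mulmxBr mulmx1 /lsq [Phi *m _]mulmxA normal_equations subrr.
have <- : col i A = atom Phi i.
  apply/colP => k; rewrite !mxE (bigD1 i)//= big1 ?addr0.
    by rewrite !mxE eqxx mulr1n iS mulr1.
  by move=> j ji; rewrite !mxE (negbTE ji) mulr0n mulr0.
have -> : col i A = A *m delta_mx i 0 by rewrite colE.
by rewrite dotvC dotv_mulmx mulmxA AQ mul0mx dotvE trmx0 mul0mx mxE.
Qed.

(** The difference of the two sides is a combination of atoms of [S] and is orthogonal to these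
    atoms, hence to itself. *)
Lemma lsq_unique S s z : supp z \subset S ->
  (forall i, i \in S -> dotv (atom Phi i) (s - Phi *m z) = 0) ->
  s - Phi *m z = resid S *m s.
Proof.
move=> zS z0; apply/eqP; rewrite -subr_eq0; apply/eqP/dotvv_eq0.
set y := lsq S *m s - z.
have yS : supp y \subset S by rewrite supp_subB ?supp_lsq.
have -> : s - Phi *m z - resid S *m s = Phi *m y.
  by rewrite residE mulmxBr opprB addrC addrA subrK.
apply: (dotv_supp0 S) => // i iS.
have -> : Phi *m y = (s - Phi *m z) - resid S *m s.
  by rewrite residE mulmxBr opprB [RHS]addrC addrA subrK.
by rewrite dotvBr z0// resid_orth// subrr.
Qed.

Lemma resid_dict S z : supp z \subset S -> resid S *m (Phi *m z) = 0.
Proof.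
move=> zS; rewrite -(lsq_unique S (Phi *m z) z) ?subrr// => i _.
by rewrite dotvE mulmx0 mxE.
Qed.

Lemma resid0 s : resid finset.set0 *m s = s.
Proof.
rewrite residE (_ : lsq _ *m s = 0) ?mulmx0 ?subr0//.
by apply/colP => i; rewrite [RHS]mxE (supp_subP _ _ (supp_lsq finset.set0 s))// inE.
Qed.

Lemma dotv_resid S s s' : dotv s (resid S *m s') = dotv (resid S *m s) (resid S *m s').
Proof.
rewrite -[s in LHS](subrK (Phi *m (lsq S *m s))) -residE.
rewrite dotvDl [X in _ + X]dotvC (dotv_supp0 S) ?supp_lsq ?addr0// => i iS.
by rewrite resid_orth.
Qed.

(** Both sides equal the product of the two projections. Self-adjointness turns correlations with a
    residual into linear forms in the noise. *)
Lemma resid_adj S s s' : dotv s (resid S *m s') = dotv (resid S *m s) s'.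
Proof. by rewrite dotv_resid [RHS]dotvC [RHS]dotv_resid [RHS]dotvC. Qed.

(** The residual is orthogonal to the atoms of [S], of which the other term is a combination. The
    minimality of [lsq] and the uniqueness of the least-squares residual both come from this
    splitting. *)
Lemma resid_pythagoras S s z : supp z \subset S ->
  dotv (s - Phi *m z) (s - Phi *m z) = dotv (resid S *m s) (resid S *m s) +
  dotv (Phi *m (lsq S *m s - z)) (Phi *m (lsq S *m s - z)).
Proof.
move=> zS; rewrite -pythagoras.
  have -> : resid S *m s + Phi *m (lsq S *m s - z) = s - Phi *m z.
    by rewrite residE mulmxBr addrA subrK.
  by [].
apply: (dotv_supp0 S) => [|i iS]; first by rewrite supp_subB ?supp_lsq.
by rewrite resid_orth.
Qed.

Lemma resid_contract S s : dotv (resid S *m s) (resid S *m s) <= dotv s s.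
Proof.
have := @resid_pythagoras S s 0; rewrite mulmx0 !subr0 => ->.
  by rewrite lerDl dotvv_ge0.
by apply/supp_subP => i _; rewrite mxE.
Qed.

Lemma lsq_least_squares S s : is_least_squares Phi s S (lsq S *m s).
Proof.
split=> [|z zS]; first exact: supp_lsq.
rewrite /l2norm ler_sqrt ?dotvv_ge0// (resid_pythagoras S s z)//.
by rewrite -residE lerDl dotvv_ge0.
Qed.

(** Minimizers may differ when the atoms of [S] are dependent, but minimality kills the second term
    of [resid_pythagoras], so they all share one residual. *)
Lemma least_squares_resid S s z : is_least_squares Phi s S z ->
  s - Phi *m z = resid S *m s.
Proof.
move=> [zS /(_ _ (supp_lsq S s))].
rewrite /l2norm ler_sqrt ?dotvv_ge0// (resid_pythagoras S s z)//.
rewrite -residE -[leRHS]addr0 lerD2l => y_le0.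
have /dotvv_eq0 : dotv (Phi *m (lsq S *m s - z)) (Phi *m (lsq S *m s - z)) = 0.
  by apply/eqP; rewrite eq_le y_le0 dotvv_ge0.
by rewrite mulmxBr => /subr0_eq <-; rewrite residE.
Qed.

End LeastSquares.

(** * Executions of OMP *)

Section Runs.
Context {R : realType} {p N : nat} (Phi : 'M[R]_(p, N)) (N_gt0 : (0 < N)%N).
Implicit Types s : 'cV[R]_p.

Lemma exists_argmax_corr (r : 'cV[R]_p) : exists j, is_argmax_corr Phi r j.
Proof.
pose i0 := Ordinal N_gt0.
exists [arg max_(i > i0) `|dotv (atom Phi i) r|]%O => i.
by case: arg_maxP => // j _; apply.
Qed.

(** An execution reduced to its selected sets: by [least_squares_resid] they determine the
    residuals, whichever minimizers are taken. *)
Definition is_omp_path s (S : nat -> {set 'I_N}) : Prop :=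
  forall t, exists j,
    is_argmax_corr Phi (resid Phi (S t) *m s) j /\ S t.+1 = (j |: S t)%SET.

(** The initial set is arbitrary because [path_safe] restarts from intermediate sets. *)
Lemma exists_omp_path s S0 : exists S, S 0%N = S0 /\ is_omp_path s S.
Proof.
have [f fP] := choice (fun S : {set 'I_N} => exists_argmax_corr (resid Phi S *m s)).
exists (fun t => iter t (fun S => f S |: S)%SET S0); split=> // t.
by eexists; split; first exact: (fP (iter t _ S0)).
Qed.

Lemma omp_run_resid s S xh r : omp_run Phi s S xh r ->
  forall t, r t = resid Phi (S t) *m s.
Proof.
move=> run [|t]; first by rewrite (omp_run_r0 run) (omp_run_S0 run) resid0.
by rewrite (omp_run_residual run) (least_squares_resid _ _ _ _ (omp_run_estimate run t)).
Qed.

Lemma omp_run_path s S xh r : omp_run Phi s S xh r -> is_omp_path s S.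
Proof.
by move=> run t; rewrite -(omp_run_resid _ _ _ _ run); exact: (omp_run_select run).
Qed.

Lemma omp_path_run s S : S 0%N = finset.set0 -> is_omp_path s S ->
  omp_run Phi s S (fun t => lsq Phi (S t) *m s) (fun t => resid Phi (S t) *m s).
Proof.
move=> S0 path; split=> //; first by rewrite S0 resid0.
  by move=> t; exact: lsq_least_squares.
by move=> t; rewrite residE.
Qed.

Lemma exists_omp_run s : exists S xh r, omp_run Phi s S xh r.
Proof.
have [S [S0 path]] := exists_omp_path s finset.set0.
by do 3 eexists; exact: omp_path_run S0 path.
Qed.

(* Quantifies over the executions from [S] by finitely many finite
   quantifiers, which makes the recovery events measurable. *)
Fixpoint safe (C E : {set 'I_N} -> Prop) s k (S : {set 'I_N}) : Prop :=
  if k is k'.+1 then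
    C S /\ forall j, is_argmax_corr Phi (resid Phi S *m s) j ->
      safe C E s k' (j |: S)%SET
  else E S.

Lemma safe_path C E s k S : safe C E s k (S 0%N) -> is_omp_path s S ->
  (forall t, (t < k)%N -> C (S t)) /\ E (S k).
Proof.
elim: k S => [|k IH] S /=; first by move=> ES _; split.
move=> [CS safeS] path.
have [j [jmax S1]] := path 0%N.
have [|Ct Ek] := IH (fun t => S t.+1) _ (fun t => path t.+1).
  by rewrite S1; exact: safeS.
by split=> // -[|t] //; exact: Ct.
Qed.

(** Since the iteration never blocks, every set reached by the finite quantifiers of [safe] lies on
    an infinite path, to which the hypothesis applies. *)
Lemma path_safe C E s k S0 :
  (forall S, S 0%N = S0 -> is_omp_path s S ->
    (forall t, (t < k)%N -> C (S t)) /\ E (S k)) ->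
  safe C E s k S0.
Proof.
elim: k S0 => [|k IH] S0 /= H.
  have [S [S0E path]] := exists_omp_path s S0.
  by have [_] := H S S0E path; rewrite S0E.
split.
  have [S [S0E path]] := exists_omp_path s S0.
  by have [/(_ 0%N erefl)] := H S S0E path; rewrite S0E.
move=> j jmax; apply: IH => S S1 path.
(* Prepends [S0] to a path that starts at [j |: S0]. *)
pose S' t := if t is t'.+1 then S t' else S0.
have [|Ct Ek] := H S' erefl; last by split=> // t tk; exact: (Ct t.+1).
by case=> [|t] /=; [exists j; rewrite S1 | exact: path].
Qed.

Lemma omp_run_safe C E s k :
  (forall S xh r, omp_run Phi s S xh r ->
    (forall t, (t < k)%N -> C (S t)) /\ E (S k)) <->
  safe C E s k finset.set0.
Proof.
split=> [H|H S xh r run].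
  by apply: path_safe => S S0 path; apply: H (omp_path_run _ _ S0 path).
by apply: safe_path (omp_run_path _ _ _ _ run); rewrite (omp_run_S0 run).
Qed.

Lemma omp_recovers_safe s m Omega : omp_recovers Phi s m Omega <->
  safe (fun=> True) (fun S => S = Omega) s m finset.set0.
Proof.
rewrite -omp_run_safe; split=> [[_ H] S xh r /H|H]; first by split.
by split=> [|S xh r /H[]//]; exact: exists_omp_run.
Qed.

Lemma tr_mulmx_atom (r : 'cV[R]_p) i : (Phi^T *m r) i 0 = dotv (atom Phi i) r.
Proof. by rewrite mxE; apply: eq_bigr => j _; rewrite !mxE. Qed.

Lemma sup_corr_le (r : 'cV[R]_p) (tau : R) : 0 <= tau ->
  `|Phi^T *m r| <= tau <-> forall i, `|dotv (atom Phi i) r| <= tau.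
Proof.
move=> tau0; rewrite /Num.norm/= mx_normrE; split=> [H i|H].
  rewrite -tr_mulmx_atom; apply: le_trans H.
  exact: (le_bigmax _ (fun ij => `|(Phi^T *m r) ij.1 ij.2|) (i, 0)).
by apply/bigmax_leP; split=> // -[i j] _ /=; rewrite ord1 tr_mulmx_atom; exact: H.
Qed.

Lemma sup_corr_gt (r : 'cV[R]_p) (tau : R) : 0 <= tau ->
  tau < `|Phi^T *m r| -> exists i, tau < `|dotv (atom Phi i) r|.
Proof.
move=> tau0 H; apply/not_existsP => le_tau.
suff : `|Phi^T *m r| <= tau by rewrite leNgt H.
by apply/sup_corr_le => // i; rewrite leNgt; apply/negP.
Qed.

Lemma lt_sup_corr (r : 'cV[R]_p) (tau : R) i : 0 <= tau ->
  tau < `|dotv (atom Phi i) r| -> tau < `|Phi^T *m r|.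
Proof.
move=> tau0; rewrite !ltNge; apply: contra.
by move/(sup_corr_le _ _ tau0).
Qed.

(** Atoms of [S] have zero correlation with the residual, whereas the maximal correlation exceeds
    [tau]. *)
Lemma argmax_corr_notin s S j (tau : R) : 0 <= tau ->
  tau < `|Phi^T *m (resid Phi S *m s)| ->
  is_argmax_corr Phi (resid Phi S *m s) j -> j \notin S.
Proof.
move=> tau0 /sup_corr_gt[//|i tau_i] jmax; apply/negP => /(resid_orth Phi S s) j0.
by have := jmax i; rewrite j0 normr0 leNgt (le_lt_trans tau0 tau_i).
Qed.

(* Each step taken before stopping adds a new atom, so a correct stopping time
   is the size of the support. *)
Lemma omp_star_recovers_safe s (tau : R) Omega : 0 <= tau ->
  omp_star_recovers Phi s tau Omega <->
  safe (fun S => tau < `|Phi^T *m (resid Phi S *m s)|)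
       (fun S => S = Omega /\ `|Phi^T *m (resid Phi S *m s)| <= tau)
       s #|Omega| finset.set0.
Proof.
move=> tau0; rewrite -omp_run_safe; split=> [[_ H] S xh r run|H].
  have [t [[le_t lt_t] StE]] := H S xh r run.
  have rE := omp_run_resid _ _ _ _ run.
  have card_S t' : (t' <= t)%N -> #|S t'| = t'.
    elim: t' => [|t' IH] t't; first by rewrite (omp_run_S0 run) cards0.
    have [j [jmax ->]] := omp_run_select run t'.
    rewrite cardsU1 (IH (ltnW t't)) (argmax_corr_notin s (S t') j tau)//.
      by rewrite -rE; exact: lt_t.
    by rewrite -rE.
  have <- : t = #|Omega| by rewrite -StE card_S.
  by split=> [t' t't|]; [rewrite -rE; exact: lt_t | rewrite -rE].
split=> [|S xh r run]; first exact: exists_omp_run.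
have rE := omp_run_resid _ _ _ _ run.
have [lt_t [SE le_t]] := H S xh r run.
by exists #|Omega|; split=> //; split=> [|t' t't]; rewrite rE//; exact: lt_t.
Qed.

End Runs.

(** * Deterministic recovery *)

Section Recovery.
Context {R : realType} {p N : nat} (Phi : 'M[R]_(p, N)).
Hypothesis Phi_norm : normalized Phi.
Notation mu := (coherence Phi).

Lemma dotv_atom1 i : dotv (atom Phi i) (atom Phi i) = 1.
Proof. by rewrite -[LHS]sqr_sqrtr ?dotvv_ge0// [Num.sqrt _]Phi_norm expr1n. Qed.

Lemma coherence_ge0 : 0 <= mu.
Proof. exact: bigmax_ge_id. Qed.

Lemma le_coherence i j : i != j -> `|dotv (atom Phi i) (atom Phi j)| <= mu.
Proof.
exact: (le_bigmax_cond (P := fun ij => ij.1 != ij.2) (j := (i, j)) 0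
  (fun ij => `|dotv (atom Phi ij.1) (atom Phi ij.2)|)).
Qed.

(** In the expansion over the atoms, the term of [i] is exactly [y i 0] because atoms have unit
    norm; each other term from [Omega] is at most [mu * M]. *)
Lemma corr_dict_approx (y : 'cV[R]_N) (Omega : {set 'I_N}) M i :
  supp y \subset Omega -> (forall j, `|y j 0| <= M) ->
  `|dotv (atom Phi i) (Phi *m y) - y i 0| <= #|Omega :\ i|%:R * (mu * M).
Proof.
move=> /supp_subP yO yM; rewrite dotv_dict (bigD1 i)//= dotv_atom1 mulr1 addrAC subrr add0r.
rewrite (bigID (mem Omega))/= [X in _ + X]big1 ?addr0; last first.
  by move=> j /andP[_ jO]; rewrite yO// mul0r.
apply: (le_trans (ler_norm_sum _ _ _)).
rewrite mulr_natl -sumr_const [leRHS](eq_bigl (fun j => (j != i) && (j \in Omega))).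
  apply: ler_sum => j /andP[ji _]; rewrite normrM mulrC.
  by apply: ler_pM => //; exact: le_coherence.
by move=> j; rewrite !inE.
Qed.

(** * Correlations with combinations of atoms of the support *)

Section Support.
Variables (Omega : {set 'I_N}) (kappa : R).
Hypotheses (Omega_gt0 : (0 < #|Omega|)%N)
  (kappaE : kappa = 1 - (2 * #|Omega|%:R - 1) * mu) (kappa_gt0 : 0 < kappa).

Let m : R := #|Omega|%:R.

Lemma exists_max_entry (y : 'cV[R]_N) : supp y \subset Omega ->
  exists2 k, k \in Omega & forall i, `|y i 0| <= `|y k 0|.
Proof.
move=> /supp_subP yO; have /card_gt0P[i0 i0O] := Omega_gt0.
case: (@arg_maxP _ _ _ i0 (mem Omega) (fun i => `|y i 0|) i0O) => k kO kmax.
exists k => // i; have [/kmax//|/yO->] := boolP (i \in Omega).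
by rewrite normr0.
Qed.

(** Here [kappa + m * mu] is [1 - (m - 1) * mu]: the largest entry suffers interference from the
    [m - 1] other atoms of [Omega]. *)
Lemma corr_in_ge (y : 'cV[R]_N) k : supp y \subset Omega -> k \in Omega ->
  (forall i, `|y i 0| <= `|y k 0|) ->
  (kappa + m * mu) * `|y k 0| <= `|dotv (atom Phi k) (Phi *m y)|.
Proof.
move=> yO kO kmax; have := corr_dict_approx y Omega _ k yO kmax.
have -> : #|Omega :\ k|%:R = m - 1.
  by rewrite /m (cardsD1 k Omega) kO add1n -[X in _ = X - _]natr1 addrK.
rewrite -normrN opprB => /(le_trans (lerB_dist _ _)); rewrite kappaE -/m.
lra.
Qed.

(** The coefficient of [i] vanishes, and only interference from the atoms of [Omega], at most [m] of
    them, remains. *)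
Lemma corr_out_le (y : 'cV[R]_N) k i : supp y \subset Omega -> i \notin Omega ->
  (forall j, `|y j 0| <= `|y k 0|) ->
  `|dotv (atom Phi i) (Phi *m y)| <= m * mu * `|y k 0|.
Proof.
move=> yO iO kmax; have := corr_dict_approx y Omega _ i yO kmax.
rewrite (supp_subP _ _ yO)// subr0 mulrA => /le_trans; apply.
by rewrite ler_wpM2r// ler_wpM2r ?coherence_ge0// ler_nat subset_leq_card// subD1set.
Qed.

(** * Recovery when the noise correlations are bounded *)

Section Signal.
Variables (x : 'cV[R]_N) (n : 'cV[R]_p) (b tau : R).
Hypotheses (x_supp : supp x \subset Omega) (tau_gt0 : 0 < tau).
Hypothesis x_large : forall i, i \in Omega -> (b + tau) / kappa <= `|x i 0|.
Hypothesis noise_in : forall i, i \in Omega -> `|dotv (atom Phi i) n| < b.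
Hypothesis noise_out : forall i, i \notin Omega ->
  `|dotv (atom Phi i) (resid Phi Omega *m n)| < tau.

Let s := Phi *m x + n.
Let xt := lsq Phi Omega *m s.

Lemma resid_signal : resid Phi Omega *m s = resid Phi Omega *m n.
Proof. by rewrite mulmxDr resid_dict// add0r. Qed.

(** [Phi *m e] is the noise minus its projection off [Omega], so its correlations with the atoms of
    [Omega] are those of the noise. Then [corr_in_ge] at the largest entry gives the bound, even
    with the larger factor [kappa + m * mu]. *)
Lemma lsq_error i : kappa * `|xt i 0 - x i 0| < b.
Proof.
set e := xt - x; have eO : supp e \subset Omega by rewrite supp_subB ?supp_lsq.
have [k kO kmax] := exists_max_entry e eO.
have -> : xt i 0 - x i 0 = e i 0 by rewrite !mxE.
have Phi_e : Phi *m e = n - resid Phi Omega *m n.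
  rewrite mulmxBr -resid_signal residE -/xt opprB addrA [n + _]addrC.
  by rewrite [s in RHS]addrC addrKA.
have := corr_in_ge e k eO kO kmax.
rewrite Phi_e dotvBr resid_orth// subr0 => /le_lt_trans/(_ (noise_in k kO)).
apply: le_lt_trans; apply: (le_trans (ler_wpM2l (ltW kappa_gt0) (kmax i))).
by rewrite ler_wpM2r// lerDl mulr_ge0 ?coherence_ge0// /m.
Qed.

(** An error below [b / kappa] leaves more than [tau / kappa] of an entry of size at least
    [(b + tau) / kappa]. *)
Lemma lsq_large i : i \in Omega -> tau < kappa * `|xt i 0|.
Proof.
move=> iO; have := x_large i iO; rewrite ler_pdivrMr// mulrC => xi.
have := lsq_error i; rewrite distrC => ei.
have := lerB_dist (x i 0) (x i 0 - xt i 0); rewrite subKr.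
move/(ler_wpM2l (ltW kappa_gt0)); rewrite mulrBr; lra.
Qed.

Lemma resid_decomp (S : {set 'I_N}) : resid Phi S *m s =
  Phi *m (xt - lsq Phi S *m s) + resid Phi Omega *m n.
Proof.
by rewrite -resid_signal (residE _ S) (residE _ Omega) mulmxBr [RHS]addrC addrA subrK.
Qed.

Lemma omp_step_correct (S : {set 'I_N}) j : S \proper Omega ->
  is_argmax_corr Phi (resid Phi S *m s) j ->
  [/\ j \in Omega, j \notin S & tau < `|dotv (atom Phi j) (resid Phi S *m s)|].
Proof.
move=> /properP[SO [i0 i0O i0S]] jmax; set y := xt - lsq Phi S *m s.
have yO : supp y \subset Omega.
  by rewrite supp_subB ?supp_lsq// (fintype.subset_trans (supp_lsq _ _ _)).
have [k kO kmax] := exists_max_entry y yO.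
(* At [i0], which [S] misses, [y] equals [xt]; the largest entry of [y] inherits the bound of
   [lsq_large]. *)
have tau_k : tau < kappa * `|y k 0|.
  apply: (lt_le_trans (lsq_large i0 i0O)); rewrite ler_pM2l//.
  apply: le_trans (kmax i0); rewrite /y [X in _ <= `|X|]mxE [X in _ <= `|_ + X|]mxE.
  by rewrite (supp_subP _ _ (supp_lsq Phi S s))// subr0.
have corr_k : (kappa + m * mu) * `|y k 0| <= `|dotv (atom Phi k) (resid Phi S *m s)|.
  by rewrite resid_decomp dotvDr resid_orth// addr0; exact: corr_in_ge.
have corr_j := le_trans corr_k (jmax k).
have mmu : 0 <= m * mu * `|y k 0| by rewrite !mulr_ge0 ?coherence_ge0// /m.
have tau_j : tau < `|dotv (atom Phi j) (resid Phi S *m s)|.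
  by move: corr_j tau_k mmu; rewrite mulrDl; lra.
split=> //.
(* Otherwise, with [M] the largest entry of [|y|], the correlation of [j] would be at least
   [(kappa + m * mu) * M] and less than [m * mu * M + tau], against [tau < kappa * M]. *)
- apply/negPn/negP => jO; have := corr_out_le y k j yO jO kmax.
  have := noise_out j jO; move: corr_j tau_k.
  rewrite resid_decomp dotvDr -/y mulrDl.
  have := ler_normD (dotv (atom Phi j) (Phi *m y)) (dotv (atom Phi j) (resid Phi Omega *m n)).
  lra.
- apply/negP => jS; move: tau_j; rewrite resid_orth// normr0.
  by move: tau_gt0; lra.
Qed.

Lemma final_corr_le i : `|dotv (atom Phi i) (resid Phi Omega *m s)| <= tau.
Proof.
have [iO|iO] := boolP (i \in Omega); first by rewrite resid_orth// normr0 ltW.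
by rewrite resid_signal ltW// noise_out.
Qed.

(** Induction on the number of atoms of [Omega] still missing. [C] and [E] stay abstract so that the
    same induction serves OMP, where [C] is trivial, and OMP*, where [C] says that the stopping test
    fails. *)
Lemma support_safe (C E : {set 'I_N} -> Prop) :
  (forall S, tau < `|Phi^T *m (resid Phi S *m s)| -> C S) -> E Omega ->
  safe Phi C E s #|Omega| finset.set0.
Proof.
move=> CP EP; have N_gt0 : (0 < N)%N.
  by have /card_gt0P[i _] := Omega_gt0; exact: leq_ltn_trans (ltn_ord i).
suff H k (S : {set 'I_N}) : S \subset Omega -> (#|S| + k)%N = #|Omega| -> safe Phi C E s k S.
  by apply: H; rewrite ?finset.sub0set// cards0.
elim: k S => [|k IH] S SO /= cardS.
  suff -> : S = Omega by [].
  by apply/eqP; rewrite eqEcard SO -cardS addn0 leqnn.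
have SO' : S \proper Omega.
  by rewrite properEcard SO -cardS addnS ltnS leq_addr.
split=> [|j /(omp_step_correct S j SO')[jO jS _]].
  (* A maximizer is needed to bound the sup norm of the correlations from below. *)
  have [j jmax] := exists_argmax_corr Phi N_gt0 (resid Phi S *m s).
  have [_ _ tau_j] := omp_step_correct S j SO' jmax.
  by apply: CP; apply: lt_sup_corr tau_j; exact: ltW.
apply: IH; first by rewrite finset.subUset finset.sub1set jO.
by rewrite cardsU1 jS add1n addSn -addnS.
Qed.

End Signal.
End Support.
End Recovery.

(** * Gaussian laws *)

Section AffineChange.
Context {R : realType}.
Local Notation mu := (@lebesgue_measure R).
Variables (v c : R) (v_neq0 : v != 0).

Let affine (x : R) : R := v * x + c.

Lemma measurable_affine : measurable_fun [set: R] affine.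
Proof.
by apply: measurable_funD => //; exact: measurable_funM.
Qed.

(** Both sides are measures in [A], so it suffices to compare them on half-open intervals. *)
Lemma lebesgue_measure_affine (A : set R) : measurable A ->
  mu A = (`|v|%:E * mu (affine @^-1` A))%E.
Proof.
have affine_itv (a b : R) :
    mu `]a, b]%classic = (`|v|%:E * mu (affine @^-1` `]a, b]%classic))%E.
  have [v0|v0|/eqP] := ltgtP v 0; last by rewrite (negbTE v_neq0).
  (* A negative [v] reverses the interval and exchanges its open and closed ends. *)
  - have -> : affine @^-1` `]a, b]%classic = `[(b - c) / v, (a - c) / v[%classic.
      apply/seteqP; split=> x /=; rewrite !in_itv/= /affine ler_ndivrMr// ltr_ndivlMr// mulrC;
      by move=> /andP[? ?]; apply/andP; split; lra.
    rewrite !lebesgue_measure_itv/= !lte_fin ltr_ndivlMr// divfK ?lt_eqF//.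
    rewrite ltrD2r; case: ifPn => _; last by rewrite mule0.
    by rewrite -!EFinB -EFinM ltr0_norm//; congr EFin; field.
  - have -> : affine @^-1` `]a, b]%classic = `](a - c) / v, (b - c) / v]%classic.
      apply/seteqP; split=> x /=; rewrite !in_itv/= /affine ler_pdivlMr// ltr_pdivrMr// mulrC;
      by move=> /andP[? ?]; apply/andP; split; lra.
    rewrite !lebesgue_measure_itv/= !lte_fin ltr_pdivlMr// divfK ?gt_eqF//.
    rewrite ltrD2r; case: ifPn => _; last by rewrite mule0.
    by rewrite -!EFinB -EFinM gtr0_norm//; congr EFin; field.
move=> mA; pose nv : {nonneg R} := NngNum (normr_ge0 v).
have := @lebesgue_measure_unique R (mscale nv
  (pushforward mu (affine : measurableTypeR R -> measurableTypeR R))).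
apply => //; first exact: measurable_affine.
by move=> ? _ [[a b]] _ <-; exact: affine_itv.
Qed.

Lemma ge0_integral_affine (f : R -> \bar R) : measurable_fun [set: R] f ->
  (forall x, 0 <= f x)%E ->
  (\int[mu]_x f x = `|v|%:E * \int[mu]_x f (affine x))%E.
Proof.
move=> mf f0; pose nv : {nonneg R} := NngNum (normr_ge0 v).
have maff := measurable_affine.
rewrite -[X in (_ * X)%E](@ge0_integral_pushforward _ _ (measurableTypeR R)
  (measurableTypeR R) R affine maff mu setT)//.
rewrite -[`|v|]/(nv%:num) -ge0_integral_mscale//.
by apply: eq_measure_integral => A mA _; exact: lebesgue_measure_affine.
Qed.

End AffineChange.

(** * Integration against normal laws and their affine images *)

Section Normal.
Context {R : realType}.
Local Notation mu := (@lebesgue_measure R).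
Local Notation gauss := (@normal_prob R 0 1).

(** The Radon-Nikodym derivative agrees with [normal_pdf] almost everywhere, because both have the
    same integral over every measurable set. *)
Lemma ge0_integral_normal (m s : R) (f : R -> \bar R) :
  measurable_fun [set: R] f -> (forall x, 0 <= f x)%E ->
  (\int[normal_prob m s]_x f x = \int[mu]_x (f x * (normal_pdf m s x)%:E))%E.
Proof.
move=> mf f0.
have dom := normal_prob_dominates m s.
rewrite -(Radon_Nikodym_SigmaFinite.change_of_variables dom f0 measurableT mf).
have mpdf : measurable_fun [set: R] (fun x => (normal_pdf m s x)%:E).
  by apply/measurable_EFinP; exact: measurable_normal_pdf.
have fint := Radon_Nikodym_SigmaFinite.f_integrable dom.
apply: ae_eq_integral => //.
- by apply: emeasurable_funM => //; exact: measurable_int fint.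
- exact: emeasurable_funM.
have : ae_eq mu [set: R] (Radon_Nikodym_SigmaFinite.f (normal_prob m s) mu)
    (fun x => (normal_pdf m s x)%:E).
  apply: integral_ae_eq => // A _ mA.
  by rewrite -Radon_Nikodym_SigmaFinite.f_integral.
by apply: filterS => x fx xT /=; rewrite fx.
Qed.

Lemma normal_pdf_affine (m s x : R) : s != 0 ->
  `|s| * normal_pdf m s (s * x + m) = normal_pdf 0 1 x.
Proof.
move=> s0; rewrite !normal_pdfE ?oner_neq0// mulrA; congr (_ * _).
  rewrite /normal_peak expr1n mul1r -mulrnAr sqrtrM ?sqr_ge0// sqrtr_sqr.
  by rewrite invfM mulrA divff ?normr_eq0// mul1r.
rewrite /normal_fun addrK subr0 expr1n; congr expR.
by field.
Qed.

Lemma normal_prob_affine (m s : R) (C : set R) : s != 0 -> measurable C ->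
  gauss [set t | C (s * t + m)] = normal_prob m s C.
Proof.
move=> s0 mC; rewrite /normal_prob [RHS]integral_mkcond [LHS]integral_mkcond/=.
rewrite [RHS](ge0_integral_affine s m s0); first last.
- by move=> x; rewrite patchE; case: ifPn => // _; rewrite lee_fin normal_pdf_ge0.
- apply/(measurable_restrictT _ mC)/measurable_funTS/measurable_EFinP.
  exact: measurable_normal_pdf.
rewrite -ge0_integralZl//; first last.
- by move=> x; rewrite patchE; case: ifPn => // _; rewrite lee_fin normal_pdf_ge0.
- apply: (measurableT_comp _ (measurable_affine s m)).
  apply/(measurable_restrictT _ mC)/measurable_funTS/measurable_EFinP.
  exact: measurable_normal_pdf.
apply: eq_integral => x _; rewrite !patchE.
rewrite -(normal_pdf_affine m s x s0) EFinM.
have -> : (x \in [set t | C (s * t + m)]) = (s * x + m \in C).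
  by apply/idP/idP; rewrite !inE.
by case: ifPn => //; rewrite mule0.
Qed.

End Normal.

(** * Combinations of two independent standard Gaussians *)

Section Rotation.
Context {R : realType}.
Local Notation mu := (@lebesgue_measure R).
Local Notation gauss := (@normal_prob R 0 1).

Lemma normal_pdf_mul (v g z t : R) : g != 0 ->
  let r := Num.sqrt (v ^+ 2 + g ^+ 2) in
  normal_pdf (v * t) g z * normal_pdf 0 1 t =
  normal_pdf 0 r z * normal_pdf (v * z / r ^+ 2) (g / r) t.
Proof.
move=> g0 r; have w0 : 0 < v ^+ 2 + g ^+ 2.
  by rewrite ltr_wpDl ?sqr_ge0// exprn_even_gt0.
have r0 : r != 0 by rewrite gt_eqF// sqrtr_gt0.
have r2 : r ^+ 2 = v ^+ 2 + g ^+ 2 by rewrite sqr_sqrtr// ltW.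
have gr0 : g / r != 0 by rewrite mulf_neq0// invr_eq0.
rewrite !normal_pdfE ?oner_neq0//.
rewrite [LHS]mulrACA [RHS]mulrACA; congr (_ * _).
  rewrite /normal_peak -!invfM -!sqrtrM ?mulrn_wge0 ?(mulr_ge0 (sqr_ge0 _) (pi_ge0 _))//.
  by congr (Num.sqrt _)^-1; rewrite exprMn exprVn r2; field; rewrite gt_eqF.
rewrite /normal_fun -!expRD; congr expR.
rewrite exprMn exprVn r2 !subr0; field.
by rewrite g0 gt_eqF.
Qed.

Lemma normal_pdf_center (m s x : R) : s != 0 ->
  normal_pdf m s x = normal_pdf 0 s (x - m).
Proof. by move=> s0; rewrite !normal_pdfE//= /normal_fun subr0. Qed.

(** The density of a centered normal law depends on its scale only through the square. *)
Lemma gauss_scale_norm (v : R) (C : set R) : measurable C ->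
  gauss [set t | C (`|v| * t)] = gauss [set t | C (v * t)].
Proof.
move=> mC; have [->|v0] := eqVneq v 0; first by rewrite normr0.
have scaleE (w : R) : w != 0 -> gauss [set t | C (w * t)] = normal_prob 0 w C.
  move=> w0; rewrite -(normal_prob_affine 0 w C w0 mC).
  by under [in RHS]eq_fun do rewrite addr0.
have nv0 : `|v| != 0 by rewrite normr_eq0.
rewrite (scaleE _ nv0) (scaleE _ v0) /normal_prob; apply: eq_integral => t _.
by rewrite !normal_pdfE ?normr_eq0//= /normal_peak /normal_fun real_normK ?num_real.
Qed.

Lemma measurable_gauss_section (v g : R) (C : set R) : measurable C ->
  measurable_fun [set: R] (fun t => gauss [set b | C (v * t + g * b)]).
Proof.
move=> mC; have mD : measurable [set z : R * R | C (v * z.1 + g * z.2)].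
  rewrite -[X in measurable X]setTI.
  have mf : measurable_fun [set: R * R] (fun z : R * R => v * z.1 + g * z.2).
    by apply: measurable_funD; apply: measurable_funM.
  exact: mf.
apply: eq_measurable_fun (measurable_fun_xsection gauss mD) => t _ /=.
rewrite [X in gauss X = _](_ : _ = [set b | C (v * t + g * b)])//.
by apply/seteqP; split=> b; rewrite /xsection/= inE.
Qed.

Lemma gauss_rotation (v g : R) (C : set R) : measurable C ->
  (\int[gauss]_t gauss [set b | C (v * t + g * b)%R] =
   gauss [set t | C (Num.sqrt (v ^+ 2 + g ^+ 2) * t)%R])%E.
Proof.
move=> mC; have [->|g0] := eqVneq g 0.
  rewrite expr0n/= addr0 sqrtr_sqr gauss_scale_norm//.
  have mvC : measurable [set t : R | C (v * t)].
    rewrite -[X in measurable X]setTI.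
    have mv : measurable_fun [set: R] (fun t => v * t) by exact: measurable_funM.
    exact: mv.
  transitivity (\int[gauss]_t (\1_[set t : R | C (v * t)] t)%:E)%E.
    apply: eq_integral => t _; rewrite indicE.
    have [Ct|Ct] := pselect (C (v * t)).
      rewrite mem_set// [X in gauss X](_ : _ = setT) ?probability_setT//.
      by apply/seteqP; split=> b //= _; rewrite mul0r addr0.
    rewrite memNset// [X in gauss X](_ : _ = set0) ?measure0//.
    by apply/seteqP; split=> b //=; rewrite mul0r addr0.
  by rewrite integral_indic// setIT.
set r := Num.sqrt _.
have r0 : r != 0 by rewrite gt_eqF// sqrtr_gt0 ltr_wpDl ?sqr_ge0// exprn_even_gt0.
rewrite ge0_integral_normal//; last exact: measurable_gauss_section.
(* The joint density of [t] and [v t + g b], cut to the values in [C] of the latter. *)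
pose f (z : R * R) := ((normal_pdf (v * z.1) g z.2 * normal_pdf 0 1 z.1)%:E *
  (\1_C z.2)%:E)%E.
have f0 z : (0 <= f z)%E.
  by rewrite mule_ge0// lee_fin ?mulr_ge0 ?normal_pdf_ge0.
have mf : measurable_fun [set: R * R] f.
  apply: emeasurable_funM; apply/measurable_EFinP.
    apply: measurable_funM; last exact: measurableT_comp (measurable_normal_pdf 0 1) _.
    apply: (@eq_measurable_fun _ _ _ _ _ (fun z : R * R => normal_pdf 0 g (z.2 - v * z.1))).
      by move=> z _; rewrite -normal_pdf_center.
    apply: (measurableT_comp (measurable_normal_pdf 0 g)).
    by apply: measurable_funB => //; exact: measurable_funM.
  exact: (measurableT_comp (measurable_indic mC)).
transitivity (\int[mu]_t \int[mu]_z f (t, z))%E.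
  apply: eq_integral => t _; rewrite [X in gauss X](_ : _ = [set b | C (g * b + v * t)]).
    rewrite normal_prob_affine// muleC /normal_prob integral_mkcond -ge0_integralZl//.
    + apply: eq_integral => z _; rewrite patchE /f/= indicE.
      by case: ifPn => _; rewrite ?mule0 ?mule1// EFinM muleC.
    + apply/(measurable_restrictT _ mC)/measurable_funTS/measurable_EFinP.
      exact: measurable_normal_pdf.
    + by move=> z _; rewrite patchE; case: ifPn => // _; rewrite lee_fin normal_pdf_ge0.
    + by rewrite lee_fin normal_pdf_ge0.
  by apply/seteqP; split=> b /=; rewrite addrC.
rewrite [LHS](@fubini_tonelli _ _ (measurableTypeR R) (measurableTypeR R) R mu mu f mf f0).
transitivity (normal_prob 0 r C); last first.
  by rewrite -normal_prob_affine//; under eq_fun do rewrite addr0.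
rewrite /normal_prob [RHS]integral_mkcond; apply: eq_integral => z _.
rewrite /f/=; under eq_integral do rewrite normal_pdf_mul// muleC EFinM muleA.
rewrite ge0_integralZl//; first last.
- by rewrite mule_ge0// lee_fin ?normal_pdf_ge0.
- by move=> t _; rewrite lee_fin normal_pdf_ge0.
- by apply/measurable_EFinP; exact: measurable_normal_pdf.
rewrite integral_normal_pdf mule1 patchE indicE.
by case: ifPn => _; rewrite ?mul0e ?mul1e.
Qed.

End Rotation.

(** * Adding an independent Gaussian on an event *)

Section GaussianSum.
Context d (T : measurableType d) (R : realType) (P : probability T R).
Local Notation gauss := (@normal_prob R 0 1).

(** On [E], the pair has a product law on rectangles, hence everywhere by uniqueness of product
    measures; [gauss_rotation] then computes the law of the sum. [E] will constrain the later
    coordinates, and [c] is its probability. *)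
Lemma gauss_sum (X Y : T -> R) (E : set T) (v g c : R) :
  measurable_fun [set: T] X -> measurable_fun [set: T] Y -> measurable E ->
  0 <= c ->
  (forall A B : set R, measurable A -> measurable B ->
    P ([set w | A (X w) /\ B (Y w)] `&` E) =
    (gauss [set t | A (v * t)%R] * (c%:E * gauss B))%E) ->
  forall C : set R, measurable C ->
    P ([set w | C (X w + g * Y w)] `&` E) =
    (gauss [set t | C (Num.sqrt (v ^+ 2 + g ^+ 2) * t)%R] * c%:E)%E.
Proof.
move=> mX mY mE c0 PXY C mC.
have mv : measurable_fun [set: R] (fun t : R => v * t) by exact: measurable_funM.
pose scale : {RV gauss >-> R} := HB.pack (fun t : measurableTypeR R => v * t : R)
  (isMeasurableFun.Build _ _ (measurableTypeR R) R _ mv).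
pose m1 := distribution gauss scale.
pose cn : {nonneg R} := NngNum c0.
pose m2 := mscale cn gauss.
pose XY w : (R * measurableTypeR R)%type := (X w, Y w).
have mXY : measurable_fun [set: T] XY.
  exact/measurable_fun_pairP.
pose D := [set z : R * R | C (z.1 + g * z.2)].
have mD : measurable D.
  rewrite -[X in measurable X]setTI.
  have mf : measurable_fun [set: R * R] (fun z : R * R => z.1 + g * z.2).
    by apply: measurable_funD => //; exact: measurable_funM.
  exact: mf.
have {PXY} <- : (m1 \x m2)%E D = P ([set w | C (X w + g * Y w)] `&` E).
  have := @product_measure_unique _ _ R (measurableTypeR R) R m1 m2
    (pushforward (mrestr P mE) XY).
  by move=> /(_ mXY) H; exact: (H PXY D mD).
have mDx : measurable_fun [set: R] (fun x => m2 (xsection D x)).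
  exact: measurable_fun_xsection.
rewrite /product_measure1 (ge0_integral_distribution scale mDx)//.
transitivity (\int[gauss]_t (c%:E * gauss [set b | C (v * t + g * b)%R]))%E.
  apply: eq_integral => t _ /=; rewrite /m2/mscale/=; congr (_ * gauss _)%E.
  by apply/seteqP; split=> b; rewrite /xsection/= inE.
rewrite ge0_integralZl//; last exact: measurable_gauss_section.
by rewrite gauss_rotation// muleC.
Qed.

End GaussianSum.

(** * Measurability under finite quantifiers *)

Section MeasurableSets.
Context d (T : measurableType d).

Lemma finite_forall_measurable (I : finType) (F : I -> set T) :
  (forall i, measurable (F i)) -> measurable [set w | forall i, F i w].
Proof.
move=> mF; rewrite (_ : [set w | _] = \bigcap_(i in [set: I]) F i).
  by apply: fin_bigcap_measurable => // i _; exact: mF.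
by apply/seteqP; split=> w /= Fw i; [move=> _; exact: Fw|exact: Fw].
Qed.

Lemma finite_exists_measurable (I : finType) (F : I -> set T) :
  (forall i, measurable (F i)) -> measurable [set w | exists i, F i w].
Proof.
move=> mF; rewrite (_ : [set w | _] = ~` [set w | forall i, (~` F i) w]).
  apply: measurableC; apply: (finite_forall_measurable _ (fun i => ~` F i)) => i.
  exact: measurableC.
by apply/seteqP; split=> w /= => [[i Fi] /(_ i)//|/existsNP[i /contrapT]]; exists i.
Qed.

Lemma measurable_set_le {R : realType} (f g : T -> R) :
  measurable_fun [set: T] f -> measurable_fun [set: T] g ->
  measurable [set w | f w <= g w].
Proof.
move=> mf mg; rewrite -[X in measurable X]setTI.
have mtrue : measurable [set true] by [].
exact: (measurable_fun_ler mf mg measurableT mtrue).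
Qed.

End MeasurableSets.

(** * Law of a linear form in the noise *)

Section GaussianLinearForm.
Context d (T : measurableType d) (R : realType) (P : probability T R).
Context (p : nat) (xi : 'I_p -> {RV P >-> R}).
Hypothesis xi_gauss : standard_gaussian_vector xi.
Variable a : 'I_p -> R.
Local Notation gauss := (@normal_prob R 0 1).

Let partial k w := \sum_(i < p | (i < k)%N) a i * xi i w.
Let scale k := Num.sqrt (\sum_(i < p | (i < k)%N) a i ^+ 2).

Lemma measurable_linear_form (Q : pred 'I_p) :
  measurable_fun [set: T] (fun w => \sum_(i < p | Q i) a i * xi i w).
Proof.
under eq_fun do rewrite big_mkcond/=.
apply: measurable_sum => i; case: (Q i) => //.
exact: measurable_funM.
Qed.

Let tail k (B : 'I_p -> set R) : set T :=
  [set w | forall i : 'I_p, (k <= i)%N -> B i (xi i w)].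

Let measurable_tail k B : (forall i, measurable (B i)) -> measurable (tail k B).
Proof.
move=> mB; apply: (finite_forall_measurable _ _ _
  (fun i : 'I_p => [set w | (k <= i)%N -> B i (xi i w)])) => i.
have mBi : measurable (xi i @^-1` B i).
  by rewrite -[X in measurable X]setTI; exact: measurable_funP.
have [ki|ki] := boolP (k <= i)%N.
  by rewrite (_ : [set w | _] = xi i @^-1` B i)//; apply/seteqP; split=> w /=; auto.
by rewrite (_ : [set w | _] = setT)//; apply/seteqP; split=> w //= _ /[!(negbTE ki)].
Qed.

(* The tail [xi_k, xi_(k+1), ...] carries the independence through the
   induction, without any statement about sigma-algebras. *)
Lemma partial_law k : (k <= p)%N ->
  forall (C : set R) (B : 'I_p -> set R), measurable C ->
  (forall i, measurable (B i)) ->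
  P ([set w | C (partial k w)] `&` tail k B) =
  (gauss [set t | C (scale k * t)%R] *
   \prod_(i < p | (k <= i)%N) gauss (B i))%E.
Proof.
have xiE i (A : set R) : measurable A -> P (xi i @^-1` A) = gauss A.
  by move=> mA; rewrite -(xi_gauss.2 i A mA).
elim: k => [_|k IH kp] C B mC mB.
  (* The empty sum has the Dirac law at 0, a Gaussian of scale 0; mutual independence yields the
     product over the full tail. *)
  have -> : scale 0 = 0 by rewrite /scale big1// sqrtr0.
  have -> : gauss [set t | C (0 * t)] = (\1_C (0 : R))%:E.
    rewrite indicE; have [C0|C0] := pselect (C 0).
      rewrite mem_set// [X in gauss X](_ : _ = setT) ?probability_setT//.
      by apply/seteqP; split=> b //= _; rewrite mul0r.
    rewrite memNset// [X in gauss X](_ : _ = set0) ?measure0//.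
    by apply/seteqP; split=> b //=; rewrite mul0r.
  have part0 w : partial 0 w = 0 by rewrite /partial big1.
  under eq_set do rewrite part0.
  rewrite indicE; have [C0|C0] := pselect (C 0); last first.
    rewrite memNset// mul0e [X in P X](_ : _ = set0) ?measure0//.
    by apply/seteqP; split=> w // -[].
  rewrite mem_set// mul1e [X in P X](_ : _ = [set w | forall i, B i (xi i w)]).
    by rewrite xi_gauss.1//; apply: eq_bigr => i _; exact: xiE.
  by apply/seteqP; split=> w /=; [move=> [_ Bw] i; exact: Bw|move=> Bw; split].
pose i0 := Ordinal kp.
have split_lt (i : 'I_p) : (i < k.+1)%N = (i == i0) || (i < k)%N.
  by rewrite ltnS leq_eqVlt -val_eqE.
have split_sum (F : 'I_p -> R) :
    \sum_(i < p | (i < k.+1)%N) F i = \sum_(i < p | (i < k)%N) F i + F i0.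
  rewrite (bigD1 i0)//= addrC; congr (_ + _); apply: eq_bigl => i.
  rewrite split_lt; have [->|_] := eqVneq i i0; first by rewrite /= ltnn.
  by rewrite /= andbT.
have split_prod (F : 'I_p -> \bar R) :
    (\prod_(i < p | (k <= i)%N) F i = F i0 * \prod_(i < p | (k < i)%N) F i)%E.
  rewrite (bigD1 i0)//=; congr (_ * _)%E; apply: eq_bigl => i.
  by rewrite ltn_neqAle -val_eqE eq_sym andbC.
pose c := fine (\prod_(i < p | (k < i)%N) gauss (B i))%E.
have cE : (\prod_(i < p | (k < i)%N) gauss (B i))%E = c%:E.
  rewrite fineK//; elim/big_ind: _ => // [x y|i _]; first exact: fin_numM.
  exact: (fin_num_measure gauss _ (mB i)).
have c0 : 0 <= c by apply/fine_ge0/prode_ge0 => i _; exact: measure_ge0.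
have partS w : partial k.+1 w = partial k w + a i0 * xi i0 w.
  by rewrite /partial split_sum.
have scaleS : scale k.+1 = Num.sqrt (scale k ^+ 2 + a i0 ^+ 2).
  rewrite {1}/scale split_sum sqr_sqrtr// sumr_ge0// => i _; exact: sqr_ge0.
rewrite scaleS cE; under eq_set do rewrite partS.
apply: gauss_sum => //; first exact: measurable_linear_form.
- exact: measurable_tail.
move=> A B0 mA mB0.
(* Reads the condition on [xi i0] as the first one of the tail from [k], so that the induction
   hypothesis applies. *)
pose B' i := if i == i0 then B0 else B i.
have mB' i : measurable (B' i) by rewrite /B'; case: eqP.
have -> : [set w | A (partial k w) /\ B0 (xi i0 w)] `&` tail k.+1 B =
    [set w | A (partial k w)] `&` tail k B'.
  apply/seteqP; split=> w /=.
    move=> [[Aw B0w] tw]; split=> // i ki; rewrite /B'; case: eqP => [->//|ni].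
    by apply: tw; rewrite ltn_neqAle ki andbT; apply/eqP => kE; apply: ni; apply/val_inj.
  move=> [Aw tw]; split; first by split=> //; have := tw i0 (leqnn k); rewrite /B' eqxx.
  move=> i ki; have := tw i (ltnW ki); rewrite /B'; case: eqP => // iE.
  by move: ki; rewrite iE /= ltnn.
rewrite IH//; last exact: ltnW.
rewrite split_prod {1}/B' eqxx -cE; congr (_ * _)%E; rewrite muleC; congr (_ * _)%E.
apply: eq_bigr => i ki; rewrite /B'; case: eqP => // iE.
by move: ki; rewrite iE /= ltnn.
Qed.

Lemma linear_form_law (C : set R) : measurable C ->
  P [set w | C (\sum_i a i * xi i w)] =
  gauss [set t | C (Num.sqrt (\sum_i a i ^+ 2) * t)].
Proof.
move=> mC; have := partial_law p (leqnn p) C (fun=> setT) mC (fun=> measurableT).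
rewrite [X in (_ * X)%E]big1; last by move=> i _; rewrite probability_setT.
have -> : tail p (fun=> setT) = setT by apply/seteqP; split=> w.
rewrite setIT mule1 /scale (eq_bigl xpredT); last by move=> i; rewrite ltn_ord.
have partE w : partial p w = \sum_i a i * xi i w.
  by apply: eq_bigl => i; rewrite ltn_ord.
by move=> <-; under [in RHS]eq_set do rewrite partE.
Qed.

End GaussianLinearForm.

(** * Gaussian tail estimate *)

Section GaussianTail.
Context {R : realType}.
Local Notation mu := (@lebesgue_measure R).
Local Notation gauss := (@normal_prob R 0 1).

Let G (t : R) : R := expR (- (t ^+ 2 / 2)).

Let derive_G (t : R) : is_derive t 1 G (- t * G t).
Proof.
have H : is_derive t 1 (fun t : R => - (t ^+ 2 / 2)) (- t).
  apply: is_derive_eq; rewrite !scaler0 ?addr0 ?add0r /GRing.scale/=.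
  by field.
have := @is_derive1_comp R expR (fun t : R => - (t ^+ 2 / 2)) t _ _ (is_derive_expR _) H.
by rewrite mulrC.
Qed.

Let continuous_G : continuous G.
Proof. by move=> t; apply/differentiable_continuous/derivable1_diffP; case: (derive_G t). Qed.

Let cvg_G : G t @[t --> +oo] --> (0 : R).
Proof.
have -> : G = gauss_fun \o (fun t => t * (Num.sqrt 2)^-1).
  apply/funext => t; rewrite /G/gauss_fun/= exprMn exprVn sqr_sqrtr//.
apply: (cvg_comp _ _ _ cvg_gauss_fun).
by apply: gt0_cvgMly => //; rewrite invr_gt0 sqrtr_gt0.
Qed.

Let normal_pdf01E t : normal_pdf 0 1 t = (Num.sqrt (2 * pi))^-1 * G t :> R.
Proof.
rewrite normal_pdfE ?oner_neq0// /normal_peak /normal_fun expr1n mul1r subr0.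
by rewrite -mulr_natl mulNr.
Qed.

(** For [t >= u] the density is at most [t / u] times itself, which has the explicit antiderivative
    [- (K / u) * G t]. *)
Lemma integral_ge_normal_pdf (u : R) : 0 < u ->
  (gauss `[u, +oo[ <= ((Num.sqrt (2 * pi))^-1 * expR (- (u ^+ 2 / 2)) / u)%:E)%E.
Proof.
move=> u0; set K := (Num.sqrt _)^-1.
have K0 : 0 <= K by rewrite invr_ge0.
have cf : continuous (fun t : R => t / u * (K * G t)).
  move=> t; apply: cvgM; first by apply: cvgM; [exact: cvg_id|exact: cvg_cst].
  by apply: cvgM; [exact: cvg_cst|exact: continuous_G].
have dF (t : R) : is_derive t 1 (fun t : R => - (K / u) * G t) (t / u * (K * G t)).
  have dG := derive_G t.
  by apply: is_derive_eq; rewrite ?scaler0 ?addr0/= /GRing.scale/=; ring.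
rewrite /normal_prob.
apply: (@le_trans _ _ (\int[mu]_(t in `[u, +oo[) (t / u * (K * G t))%:E)%E).
  apply: ge0_le_integral => //=.
  - by move=> t _; rewrite lee_fin normal_pdf_ge0.
  - by apply/measurable_EFinP/measurable_funTS; exact: measurable_normal_pdf.
  - by apply/measurable_EFinP/measurable_funTS; exact: continuous_measurable_fun.
  - move=> t; rewrite in_itv/= andbT => ut; rewrite lee_fin normal_pdf01E -/K ler_peMl//.
      by rewrite mulr_ge0 ?expR_ge0.
    by rewrite ler_pdivlMr// mul1r.
rewrite (@ge0_continuous_FTC2y R _ (fun t : R => - (K / u) * G t) u 0)//.
- by rewrite sub0e -EFinN lee_fin mulNr opprK mulrAC.
- by move=> t ut; rewrite !mulr_ge0 ?expR_ge0 ?invr_ge0 ?(ltW u0)// (le_trans (ltW u0)).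
- exact: continuous_subspaceT.
- rewrite -(mulr0 (- (K / u))); apply: cvgM; [exact: cvg_cst|exact: cvg_G].
- apply: cvg_at_right_filter; apply: cvgM; [exact: cvg_cst|exact: continuous_G].
- by move=> t _; rewrite derive1E; case: (dF t).
Qed.

Lemma gauss_tail (u : R) : 0 < u ->
  (gauss [set t : R | (u <= `|t|)%R] <=
   (2 * ((Num.sqrt (2 * pi))^-1 * expR (- (u ^+ 2 / 2)) / u))%:E)%E.
Proof.
move=> u0; have sym : gauss `]-oo, - u] = gauss `[u, +oo[.
  have := gauss_scale_norm (-1) `[u, +oo[%classic (measurable_itv _).
  under eq_set do rewrite normrN1 mul1r.
  move=> ->; rewrite [X in gauss X = _](_ : _ = [set t | `[u, +oo[%classic (-1 * t)])//.
  by apply/seteqP; split=> t /=; rewrite !in_itv/= ?andbT mulN1r lerNr.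
have -> : [set t : R | u <= `|t|] = `]-oo, - u] `|` `[u, +oo[.
  apply/seteqP; split=> t /=; rewrite !in_itv/= andbT ler_normr lerNr.
    by move=> /orP[]; auto.
  by case=> ->; rewrite ?orbT.
apply: (le_trans (measureU2 _ _ _)) => //.
rewrite mulr_natl mulr2n EFinD; apply: leeD; last exact: integral_ge_normal_pdf.
by have := integral_ge_normal_pdf u u0; rewrite -sym.
Qed.

End GaussianTail.

(** * Recovery probability *)

Section Noise.
Context d (T : measurableType d) (R : realType) (P : probability T R).
Context (p N : nat) (Phi : 'M[R]_(p, N)) (x : 'cV[R]_N) (sigma : R).
Context (xi : 'I_p -> {RV P >-> R}).
Let noise w : 'cV[R]_p := \col_i xi i w.
Let s := noisy_signal Phi x sigma xi.

Lemma dotv_noise (v : 'cV[R]_p) w : dotv v (noise w) = \sum_i v i 0 * xi i w.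
Proof. by apply: eq_bigr => i _; rewrite mxE. Qed.

Lemma measurable_dotv_noise (v : 'cV[R]_p) :
  measurable_fun [set: T] (fun w => dotv v (noise w)).
Proof.
under eq_fun do rewrite dotv_noise.
exact: (measurable_linear_form _ _ _ _ _ xi (fun i => v i 0) xpredT).
Qed.

Lemma measurable_corr (S : {set 'I_N}) i :
  measurable_fun [set: T] (fun w => `|dotv (atom Phi i) (resid Phi S *m s w)|).
Proof.
apply: measurableT_comp => //.
under eq_fun do rewrite resid_adj dotvDr dotvZr.
apply: measurable_funD => //; apply: measurable_funM => //.
exact: measurable_dotv_noise.
Qed.

Lemma measurable_argmax_corr (S : {set 'I_N}) j :
  measurable [set w | is_argmax_corr Phi (resid Phi S *m s w) j].
Proof.
apply: (finite_forall_measurable _ _ _ (fun i => [set w | _ <= _])) => i.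
by apply: measurable_set_le; exact: measurable_corr.
Qed.

(** Each step is a finite intersection of implications, and an implication is a union with a
    complement. *)
Lemma measurable_safe (C E : T -> {set 'I_N} -> Prop) k (S : {set 'I_N}) :
  (forall S, measurable [set w | C w S]) ->
  (forall S, measurable [set w | E w S]) ->
  measurable [set w | safe Phi (C w) (E w) (s w) k S].
Proof.
move=> mC mE; elim: k S => [|k IH] S /=; first exact: mE.
apply: (measurableI [set w | C w S] [set w | forall j, _ -> _]) => //.
apply: (finite_forall_measurable _ _ _ (fun j => [set w | _ -> _])) => j.
rewrite (_ : [set w | _] =
  ~` [set w | is_argmax_corr Phi (resid Phi S *m s w) j] `|`
  [set w | safe Phi (C w) (E w) (s w) k (j |: S)%SET]).
  by apply: measurableU => //; apply: measurableC; exact: measurable_argmax_corr.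
apply/seteqP; split=> w /=; last by case.
by case: (pselect (is_argmax_corr Phi (resid Phi S *m s w) j)); auto.
Qed.

Lemma measurable_sup_corr_le (tau : R) (S : {set 'I_N}) : 0 <= tau ->
  measurable [set w | `|Phi^T *m (resid Phi S *m s w)| <= tau].
Proof.
move=> tau0; rewrite (_ : [set w | _] =
  [set w | forall i, `|dotv (atom Phi i) (resid Phi S *m s w)| <= tau]).
  apply: (finite_forall_measurable _ _ _ (fun i => [set w | _ <= _])) => i.
  by apply: measurable_set_le => //; exact: measurable_corr.
by apply/seteqP; split=> w /= /(sup_corr_le _ _ _ tau0).
Qed.

Lemma measurable_omp_recovers m (Omega : {set 'I_N}) : (0 < N)%N ->
  measurable [set w | omp_recovers Phi (s w) m Omega].
Proof.
move=> N0; under eq_set => w do rewrite (propext (omp_recovers_safe Phi N0 _ _ _)).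
apply: (measurable_safe (fun _ _ => True) (fun _ S => S = Omega)) => S.
  exact: measurableT.
have [->|SO] := pselect (S = Omega).
  by rewrite (_ : [set w | _] = setT)//; apply/seteqP; split.
by rewrite (_ : [set w | _] = set0)//; apply/seteqP; split.
Qed.

Lemma measurable_omp_star_recovers (tau : R) (Omega : {set 'I_N}) :
  (0 < N)%N -> 0 <= tau ->
  measurable [set w | omp_star_recovers Phi (s w) tau Omega].
Proof.
move=> N0 tau0.
under eq_set => w do rewrite (propext (omp_star_recovers_safe Phi N0 _ _ _ tau0)).
apply: (measurable_safe
  (fun w S => tau < `|Phi^T *m (resid Phi S *m s w)|)
  (fun w S => S = Omega /\ `|Phi^T *m (resid Phi S *m s w)| <= tau)) => S.
  rewrite (_ : [set w | _] =
    ~` [set w | `|Phi^T *m (resid Phi S *m s w)| <= tau]).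
    by apply: measurableC; exact: measurable_sup_corr_le.
  by apply/seteqP; split=> w /=; rewrite ltNge; move/negP.
have [->|SO] := pselect (S = Omega).
  rewrite (_ : [set w | _] = [set w | `|Phi^T *m (resid Phi Omega *m s w)| <= tau]).
    exact: measurable_sup_corr_le.
  by apply/seteqP; split=> w /=; [case|].
by rewrite (_ : [set w | _] = set0)//; apply/seteqP; split=> w //= -[].
Qed.

Lemma union_bound (I : finType) (F : I -> set T) :
  (forall i, measurable (F i)) ->
  (P [set w | exists i, F i w] <= \sum_i P (F i))%E.
Proof.
move=> mF; rewrite fsbig_seq ?index_enum_uniq//.
apply: content_sub_fsum => //.
  exact: finite_exists_measurable.
by move=> w /= [i Fi]; exists i => //=; exact: mem_index_enum.
Qed.

Hypothesis xi_gauss : standard_gaussian_vector xi.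

(** The correlation is a standard Gaussian scaled by the norm of [v]; as this is at most 1,
    exceeding [u] forces the unscaled variable to exceed it too. *)
Lemma noise_tail (v : 'cV[R]_p) (u : R) : dotv v v <= 1 -> 0 < u ->
  (P [set w | (u <= `|dotv v (noise w)|)%R] <=
   (2 * ((Num.sqrt (2 * pi))^-1 * expR (- (u ^+ 2 / 2)) / u))%:E)%E.
Proof.
move=> v1 u0; apply: le_trans (gauss_tail u u0).
pose C := [set z : R | u <= `|z|].
have mC : measurable C by apply: measurable_set_le => //; exact: measurableT_comp.
under eq_set => w do rewrite dotv_noise.
rewrite (linear_form_law _ _ _ _ _ _ xi_gauss (fun i => v i 0) C mC).
apply: le_measure; rewrite ?inE//.
  rewrite -[X in measurable X]setTI.
  have mv : measurable_fun [set: R] (fun t => Num.sqrt (\sum_i v i 0 ^+ 2) * t).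
    exact: measurable_funM.
  exact: mv.
move=> t; rewrite /C/= normrM => /le_trans; apply.
rewrite ler_piMl// ger0_norm// -(@sqrtr1 R) ler_sqrt//.
Qed.

End Noise.

(** * The tail bound at the chosen thresholds *)

Section Bound.
Context {R : realType}.

(** Since [u ^+ 2 / 2] is [th * (1 + alpha) * ln n], the exponential is a power of [n]. It is used
    with [th = beta] on the support and [th = 1] off it. *)
Lemma tail_at_threshold (n th alpha : R) : 1 < n -> 0 < th -> 0 <= alpha ->
  let u := Num.sqrt th * Num.sqrt (2 * (1 + alpha) * ln n) in
  2 * ((Num.sqrt (2 * pi))^-1 * expR (- (u ^+ 2 / 2)) / u) =
  (Num.sqrt (pi * (1 + alpha) * ln n))^-1 *
    ((n `^ th)^-1 * (n `^ (alpha * th))^-1 * (Num.sqrt th)^-1).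
Proof.
move=> n1 th0 alpha0 u; have L0 : 0 < ln n by rewrite ln_gt0.
have n0 : 0 < n by exact: lt_trans n1.
have a0 : 0 < 1 + alpha by rewrite ltr_pwDl.
have uE : u ^+ 2 / 2 = (th + alpha * th) * ln n.
  rewrite exprMn !sqr_sqrtr ?(ltW th0)//; first by field.
  by rewrite !mulr_ge0 ?(ltW a0) ?(ltW L0).
have powE : expR (- (u ^+ 2 / 2)) = (n `^ th)^-1 * (n `^ (alpha * th))^-1.
  rewrite uE -invfM -powRD; last by rewrite (gt_eqF n0) implybT.
  by rewrite -powRN /powR gt_eqF// mulNr.
have pi0 := @pi_gt0 R.
have sqrtE : Num.sqrt (2 * pi) * Num.sqrt (2 * (1 + alpha) * ln n) =
    2 * Num.sqrt (pi * (1 + alpha) * ln n).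
  have -> : 2 = Num.sqrt (2 ^+ 2) :> R by rewrite sqrtr_sqr ger0_norm.
  rewrite -!sqrtrM ?mulr_ge0 ?ltW// ?exprn_gt0//.
  by congr Num.sqrt; rewrite sqrtr_sqr ger0_norm//; ring.
rewrite powE /u; move: sqrtE.
set A := Num.sqrt (2 * pi); set B := Num.sqrt (_ * ln n).
set C := Num.sqrt (_ * ln n); set D := Num.sqrt th => AB.
have C0 : C != 0 by rewrite gt_eqF// sqrtr_gt0 !mulr_gt0.
have -> : 2 * (A^-1 * ((n `^ th)^-1 * (n `^ (alpha * th))^-1) / (D * B)) =
  2 * (A * B)^-1 * ((n `^ th)^-1 * (n `^ (alpha * th))^-1 * D^-1).
  by rewrite !invfM; ring.
by rewrite AB invfM (mulrA 2) divff// mul1r.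
Qed.

End Bound.

(** * The good event and its consequences *)

Section Assembly.
Context (R : realType) (d : measure_display) (T : measurableType d)
  (P : probability T R) (p N : nat) (Phi : 'M[R]_(p, N)) (x : 'cV[R]_N)
  (sigma alpha beta : R) (xi : 'I_p -> {RV P >-> R}).
Let m : R := (l0norm x)%:R.
Let U := Num.sqrt (2 * (1 + alpha) * ln N%:R).
Hypotheses (hN : (2 <= N)%N) (hPhi : normalized Phi) (hsigma : 0 < sigma)
  (hxi : standard_gaussian_vector xi)
  (hmu : coherence Phi < 1 / (2 * m - 1)) (hbeta : 0 < beta < 1)
  (hmN : m <= N%:R `^ beta) (halpha : 0 <= alpha)
  (hxmin : sigma / (1 - (2 * m - 1) * coherence Phi) *
             (1 + Num.sqrt beta) * U <= xmin x).

Let test i : 'cV[R]_p :=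
  if i \in supp x then atom Phi i else resid Phi (supp x) *m atom Phi i.
(** Lowering the threshold on the support costs a tail factor [N^-beta] instead of [N^-1], which the
    at most [N^beta] tests made there can afford. This is the origin of [1 + sqrt beta] in the bound
    on [xmin]. *)
Let threshold i : R := if i \in supp x then Num.sqrt beta * U else U.

Let noise w : 'cV[R]_p := \col_i xi i w.
Let bad i := [set w | threshold i <= `|dotv (test i) (noise w)|].
Let good := [set w | forall i, `|dotv (test i) (noise w)| < threshold i].

Let n_gt1 : 1 < N%:R :> R.
Proof. by rewrite ltr1n. Qed.

Let U_gt0 : 0 < U.
Proof. by rewrite sqrtr_gt0 !mulr_gt0 ?ltr_pwDl ?ln_gt0. Qed.

Let beta_gt0 : 0 < beta. Proof. by case/andP: hbeta. Qed.

Let test_le1 i : dotv (test i) (test i) <= 1.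
Proof.
rewrite -(dotv_atom1 Phi hPhi i) /test; case: ifP => _; first exact: lexx.
exact: resid_contract.
Qed.

Let prefactor := (Num.sqrt (pi * (1 + alpha) * ln (N%:R : R)))^-1.

Let bad_in i : i \in supp x -> (P (bad i) <= (prefactor *
  ((N%:R `^ beta)^-1 * (N%:R `^ (alpha * beta))^-1 * (Num.sqrt beta)^-1))%:E)%E.
Proof.
move=> iO; rewrite /prefactor -tail_at_threshold// /bad /threshold iO.
by apply: noise_tail => //; rewrite mulr_gt0// sqrtr_gt0.
Qed.

Let bad_out i : i \notin supp x -> (P (bad i) <= (prefactor *
  (N%:R^-1 * (N%:R `^ alpha)^-1))%:E)%E.
Proof.
move=> iO; have -> : prefactor * (N%:R^-1 * (N%:R `^ alpha)^-1) =
    prefactor * ((N%:R `^ 1)^-1 * (N%:R `^ (alpha * 1))^-1 * (Num.sqrt 1)^-1).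
  by rewrite powRr1 ?ler0n// mulr1 sqrtr1 invr1 mulr1.
rewrite /prefactor -tail_at_threshold// sqrtr1 mul1r /bad /threshold (negbTE iO).
exact: noise_tail.
Qed.

Let measurable_bad i : measurable (bad i).
Proof.
apply: measurable_set_le => //; apply: measurableT_comp => //.
exact: measurable_dotv_noise.
Qed.

Let goodC : ~` good = [set w | exists i, bad i w].
Proof.
apply/seteqP; split=> w; first by move=> /existsNP[i /negP]; rewrite -leNgt; exists i.
by move=> [i]; rewrite /bad/= leNgt => /negP bi /(_ i).
Qed.

Let measurable_good : measurable good.
Proof.
rewrite -[good]setCK; apply: measurableC; rewrite goodC.
exact: finite_exists_measurable.
Qed.

(** The union bound sums [m] terms [qin] and at most [N] terms [qout]; the counts are absorbed by
    the factors [N^-beta] and [N^-1]. *)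
Lemma good_probability : ((recovery_bound N alpha beta)%:E <= P good)%E.
Proof.
have n0 : 0 < N%:R :> R by exact: lt_trans n_gt1.
have K0 : 0 <= prefactor by rewrite invr_ge0.
pose qin := prefactor * ((N%:R `^ beta)^-1 * (N%:R `^ (alpha * beta))^-1 * (Num.sqrt beta)^-1).
pose qout := prefactor * (N%:R^-1 * (N%:R `^ alpha)^-1).
have Nb : 0 < N%:R `^ beta :> R by rewrite powR_gt0.
have qin0 : 0 <= qin by rewrite !mulr_ge0 ?invr_ge0 ?powR_ge0.
have qout0 : 0 <= qout by rewrite !mulr_ge0 ?invr_ge0 ?powR_ge0.
have bad_le : (P (~` good) <= (m * qin + N%:R * qout)%:E)%E.
  rewrite goodC; apply: (le_trans (union_bound d T R P _ bad measurable_bad)).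
  rewrite (bigID (mem (supp x)))/= EFinD; apply: leeD.
    apply: (@le_trans _ _ (\sum_(i in supp x) qin%:E)%E); first exact: lee_sum.
    by rewrite sumEFin lee_fin sumr_const -mulr_natl.
  apply: (@le_trans _ _ (\sum_(i | i \notin supp x) qout%:E)%E); first exact: lee_sum.
  rewrite sumEFin lee_fin sumr_const -[leLHS]mulr_natl ler_wpM2r// ler_nat.
  by rewrite -[leqRHS]card_ord max_card.
have : (1 - (m * qin + N%:R * qout)%:E <= P good)%E.
  rewrite -[good]setCK probability_setC; last exact: measurableC.
  by apply: leeB.
apply: le_trans; rewrite -EFinB lee_fin /recovery_bound lerD2l lerN2 -/prefactor mulrDr addrC.
apply: lerD.
  by rewrite /qout mulrCA ler_wpM2l// mulrA divff ?gt_eqF// mul1r.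
rewrite /qin mulrCA ler_wpM2l// invfM mulrA mulrA ler_wpM2r ?invr_ge0//.
by rewrite ler_piMl ?invr_ge0 ?powR_ge0// ler_pdivrMr// mul1r.
Qed.

Section Realization.
Variable w : T.
Hypothesis w_good : good w.

Let kappa := 1 - (2 * m - 1) * coherence Phi.

(** For an empty support, [hmu] would make the coherence less than [-1]. *)
Lemma l0norm_gt0 : (0 < #|supp x|)%N.
Proof.
rewrite lt0n; apply/negP => /eqP m0; move: hmu (coherence_ge0 Phi).
rewrite /m /l0norm m0 mulr0 sub0r invrN1 mul1r; lra.
Qed.

Let kappa_gt0 : 0 < kappa.
Proof.
have m1 : 1 <= m by rewrite ler1n l0norm_gt0.
by rewrite subr_gt0 mulrC -ltr_pdivlMr//; lra.
Qed.

Let x_large i : i \in supp x ->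
  (sigma * (Num.sqrt beta * U) + sigma * U) / kappa <= `|x i 0|.
Proof.
move=> iO; apply: (@le_trans _ _ (xmin x)); last exact: bigmin_le_cond.
apply: le_trans hxmin; rewrite le_eqVlt; apply/orP; left; apply/eqP; rewrite -/kappa; ring.
Qed.

Let noise_in i : i \in supp x ->
  `|dotv (atom Phi i) (sigma *: noise w)| < sigma * (Num.sqrt beta * U).
Proof.
move=> iO; rewrite dotvZr normrM gtr0_norm// ltr_pM2l//.
by have := w_good i; rewrite /test /threshold iO.
Qed.

Let noise_out i : i \notin supp x ->
  `|dotv (atom Phi i) (resid Phi (supp x) *m (sigma *: noise w))| < sigma * U.
Proof.
move=> iO; rewrite resid_adj dotvZr normrM gtr0_norm// ltr_pM2l//.
by have := w_good i; rewrite /test /threshold (negbTE iO).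
Qed.

Let tau_gt0 : 0 < sigma * U. Proof. by rewrite mulr_gt0. Qed.

Let safeP := support_safe Phi hPhi (supp x) kappa l0norm_gt0 erefl kappa_gt0
  x (sigma *: noise w) (sigma * (Num.sqrt beta * U)) (sigma * U)
  (subxx _) tau_gt0 x_large noise_in noise_out.

Lemma good_omp_recovers :
  omp_recovers Phi (noisy_signal Phi x sigma xi w) (l0norm x) (supp x).
Proof.
apply/omp_recovers_safe; first exact: ltnW.
exact: safeP.
Qed.

Lemma good_omp_star_recovers :
  omp_star_recovers Phi (noisy_signal Phi x sigma xi w) (sigma * U) (supp x).
Proof.
apply/omp_star_recovers_safe; [exact: ltnW|exact: ltW|].
(* Not having stopped is what [support_safe] supplies; it remains that the stopping test passes once
   the support is complete. *)
apply: safeP => //; split=> //; apply/sup_corr_le; first exact: ltW.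
move=> i; exact: (final_corr_le Phi (supp x) x).
Qed.

End Realization.

Let N_gt0 : (0 < N)%N. Proof. exact: ltnW. Qed.

Lemma omp_recovers_probability : ((recovery_bound N alpha beta)%:E <=
  P [set w | omp_recovers Phi (noisy_signal Phi x sigma xi w) (l0norm x) (supp x)])%E.
Proof.
apply: (le_trans good_probability); apply: le_measure; rewrite ?inE//.
  exact: measurable_omp_recovers.
exact: good_omp_recovers.
Qed.

Lemma omp_star_recovers_probability : ((recovery_bound N alpha beta)%:E <=
  P [set w | omp_star_recovers Phi (noisy_signal Phi x sigma xi w) (sigma * U)%R (supp x)])%E.
Proof.
apply: (le_trans good_probability); apply: le_measure; rewrite ?inE//.
  by apply: measurable_omp_star_recovers => //; rewrite mulr_ge0 ?ltW.
exact: good_omp_star_recovers.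
Qed.

End Assembly.

Theorem theorem2 (R : realType) (d : measure_display) (T : measurableType d)
    (P : probability T R) (p N m : nat) (Phi : 'M[R]_(p, N)) (x : 'cV[R]_N)
    (sigma alpha beta : R) (xi : 'I_p -> {RV P >-> R})
    (hN : (2 <= N)%N)
    (hPhi : normalized Phi)
    (hm : l0norm x = m)
    (hsigma : 0 < sigma)
    (hxi : standard_gaussian_vector xi)
    (hmu : coherence Phi < 1 / (2 * m%:R - 1))
    (hbeta : 0 < beta < 1)
    (hmN : m%:R <= N%:R `^ beta)
    (halpha : 0 <= alpha)
    (hxmin : sigma / (1 - (2 * m%:R - 1) * coherence Phi) *
               (1 + Num.sqrt beta) * Num.sqrt (2 * (1 + alpha) * ln N%:R)
             <= xmin x) :
  let s := noisy_signal Phi x sigma xi in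
  let tau := sigma * Num.sqrt (2 * (1 + alpha) * ln N%:R) in
  let omp_success := [set w | omp_recovers Phi (s w) m (supp x)] in
  let omp_star_success := [set w | omp_star_recovers Phi (s w) tau (supp x)] in
  (measurable omp_success /\
   ((recovery_bound N alpha beta)%:E <= P omp_success)%E) /\
  (measurable omp_star_success /\
   ((recovery_bound N alpha beta)%:E <= P omp_star_success)%E).
Proof.
move=> s tau omp_success omp_star_success; subst m.
have N_gt0 : (0 < N)%N by exact: ltnW.
have tau_ge0 : 0 <= tau by rewrite mulr_ge0 ?sqrtr_ge0// ltW.
split; split.
- exact: measurable_omp_recovers.
- exact: omp_recovers_probability.
- exact: measurable_omp_star_recovers.
- exact: omp_star_recovers_probability.
Qed.
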